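(* For every $h\in\mathbb{F}$ and every positive integer $n$, the operator $R_{\mathfrak p}\in\operatorname{End}(V_n\otimes V_n)$ obtained by restricting $$\tilde F_h-\frac{hn}{z_1-z_2+h}\,(\tilde F_h-P)$$ to $V_n\otimes V_n$ satisfies the Yang-Baxter equation $$R_{12}R_{13}R_{23}=R_{23}R_{13}R_{12}\qquad (R=R_{\mathfrak p})$$ on $V_n\otimes V_n\otimes V_n$.
   Context: $\mathbb{F}$ is an algebraically closed field of characteristic zero. $\mathbb{F}(z_1,z_2)$ is the field of rational functions in two variables. The linear operators $P$ and $\tilde F_h$ on $\mathbb{F}(z_1,z_2)$ are $(P f)(z_1,z_2)=f(z_2,z_1)$ and $(\tilde F_h f)(z_1,z_2)=f(z_1+h,z_2-h)$; rational functions act by multiplication. $V_n$ is the space of polynomials in one variable of degree less than $n$, and $V_n\otimes V_n$ is identified with the subspace of $\mathbb{F}(z_1,z_2)$ of polynomials of degree less than $n$ in each of $z_1$ and $z_2$ (the first tensor factor corresponds to $z_1$, the second to $z_2$). The operator displayed in the claim preserves this subspace; on monomials it is $$z_1^iz_2^j\mapsto (z_1+h)^i(z_2-h)^j-hn\,\frac{(z_1+h)^i(z_2-h)^j-z_2^iz_1^j}{z_1-z_2+h}.$$ As usual, for $R\in\operatorname{End}(V\otimes V)$, $R_{ij}$ denotes the operator on $V\otimes V\otimes V$ acting as $R$ in the $i$-th and $j$-th factors and trivially in the remaining one. *)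

(* Defs.v *)
From HB Require Import structures.
From mathcomp Require Import all_boot all_order all_algebra.
From mathcomp Require Import generic_quotient.
From mathcomp Require Import mpoly ring.

Set Implicit Arguments.
Unset Strict Implicit.
Unset Printing Implicit Defensive.

Import GRing.Theory.
Local Open Scope ring_scope.
Local Open Scope quotient_scope.

Notation "x %:F" := (@FracField.tofrac _ x) : ring_scope.

(* Extension of f to fields of fractions, num/den |-> f num / f den.          *)
(* It is meaningful only for injective f, see frac_mapE.                      *)
Definition frac_map (A B : idomainType) (f : A -> B) (x : {fraction A}) :
    {fraction B} :=
  (f (\n_(repr x)))%:F / (f (\d_(repr x)))%:F.

Section FracMap.
Variables (A B : idomainType) (f : {rmorphism A -> B}).
Hypothesis f_inj : injective f.

Lemma frac_repr (x : {fraction A}) :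
  x = (\n_(repr x))%:F / (\d_(repr x))%:F.
Proof.
apply/(canRL (mulfK _)); first by rewrite tofrac_eq0 denom_ratioP.
rewrite -{1}[x]reprK; unlock FracField.tofrac.
rewrite -[LHS]FracField.pi_mul; apply/eqmodP => /=.
rewrite FracField.equivfE /FracField.mulf /=.
by rewrite !numden_Ratio ?oner_eq0 ?mulr1 ?denom_ratioP // mulrC.
Qed.

Lemma frac_mapE (a b : A) :
  b != 0 -> frac_map f (a%:F / b%:F) = (f a)%:F / (f b)%:F.
Proof.
move=> b0; pose x : {fraction A} := a%:F / b%:F; rewrite /frac_map -/x.
have fn0 c : c != 0 -> (f c)%:F != 0.
  by rewrite tofrac_eq0 -(inj_eq f_inj) rmorph0.
apply/eqP; rewrite eqr_div ?fn0 ?denom_ratioP // -!tofracM -!rmorphM tofrac_eq.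
apply/eqP; congr (f _); apply/eqP; rewrite -tofrac_eq !tofracM.
by rewrite -eqr_div ?tofrac_eq0 ?denom_ratioP // -frac_repr.
Qed.

Lemma frac_map_tofrac (a : A) : frac_map f a%:F = (f a)%:F.
Proof.
by rewrite -[a%:F]divr1 -tofrac1 frac_mapE ?oner_eq0 // rmorph1 tofrac1 divr1.
Qed.

End FracMap.

Section TensorPower.
Variables (F : fieldType) (k n : nat).

Definition vardeg_lt_pred : pred {mpoly F[k]} :=
  fun p => all (fun m : 'X_{1..k} => [forall i, m i < n]%N) (msupp p).

Definition vardeg_lt := [qualify a p | vardeg_lt_pred p].

Lemma vardeg_ltP p :
  reflect (forall m, m \in msupp p -> forall i, (m i < n)%N)
          (p \is a vardeg_lt).
Proof.
by apply: (iffP allP) => H m /H; [move/forallP | move=> ?; apply/forallP].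
Qed.

Lemma vardeg_lt_submod_closed : submod_closed vardeg_lt.
Proof.
split=> [|c p q /vardeg_ltP Hp /vardeg_ltP Hq].
  by apply/vardeg_ltP => m; rewrite -mpolyC0 msupp0.
apply/vardeg_ltP => m /msuppD_le; rewrite mem_cat => /orP[|/Hq//].
by move/msuppZ_le/Hp.
Qed.

HB.instance Definition _ :=
  GRing.isSubmodClosed.Build F {mpoly F[k]} vardeg_lt_pred vardeg_lt_submod_closed.

(* The k-th tensor power of V_n = {p : {poly F} | size p <= n}, seen as the   *)
(* space of polynomials in k variables of degree < n in each of them: the     *)
(* i-th tensor factor corresponds to 'X_i.                                    *)
Record Vtens := VTens { vtens_val :> {mpoly F[k]};
                        vtensP : vtens_val \is a vardeg_lt }.

HB.instance Definition _ := [isSub for vtens_val].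
HB.instance Definition _ := [Choice of Vtens by <:].
HB.instance Definition _ := [SubChoice_isSubLmodule of Vtens by <:].

Lemma vtens_lt (p : Vtens) m : m \in msupp (val p) -> forall i, (m i < n)%N.
Proof. by move: m; apply/vardeg_ltP/vtensP. Qed.

End TensorPower.

Section DegreeBounds.
Variables (F : fieldType) (k : nat).
Implicit Types (p q : {mpoly F[k]}) (d : 'I_k -> nat).

Definition vdeg_le d p := forall m, m \in msupp p -> forall l, (m l <= d l)%N.

Lemma vdeg_le_lt n d p :
  vdeg_le d p -> (forall l, d l < n)%N -> p \is a @vardeg_lt F k n.
Proof.
by move=> Hp Hd; apply/vardeg_ltP => m /Hp Hm l; apply: leq_ltn_trans (Hd l).
Qed.

Lemma vdeg_leC d (c : F) : vdeg_le d c%:MP.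
Proof.
move=> m; rewrite msuppC; case: ifP => // _; rewrite inE => /eqP-> l.
by rewrite mnm0E.
Qed.

Lemma vdeg_leD d p q : vdeg_le d p -> vdeg_le d q -> vdeg_le d (p + q).
Proof. by move=> Hp Hq m /msuppD_le; rewrite mem_cat => /orP[/Hp|/Hq]. Qed.

Lemma vdeg_leM d d' p q : vdeg_le d p -> vdeg_le d' q ->
  vdeg_le (fun l => d l + d' l)%N (p * q).
Proof.
move=> Hp Hq m /msuppM_le/allpairsP[[m1 m2] /= [/Hp H1 /Hq H2 ->]] l.
by rewrite mnmDE leq_add.
Qed.

Lemma vdeg_le_exp d p e : vdeg_le d p -> vdeg_le (fun l => d l * e)%N (p ^+ e).
Proof.
move=> Hp; elim: e => [|e IH]; first by rewrite expr0 -mpolyC1; exact: vdeg_leC.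
by rewrite exprS => m /(vdeg_leM Hp IH) Hm l; rewrite mulnS.
Qed.

Lemma vdeg_le_prod I (r : seq I) (P : pred I) (d : I -> 'I_k -> nat)
    (G : I -> {mpoly F[k]}) :
  (forall i, P i -> vdeg_le (d i) (G i)) ->
  vdeg_le (fun l => \sum_(i <- r | P i) d i l)%N (\prod_(i <- r | P i) G i).
Proof.
move=> H; elim: r => [|i r IH].
  by rewrite big_nil -mpolyC1; exact: vdeg_leC.
rewrite big_cons; case: ifP => Pi m.
  move/(vdeg_leM (H i Pi) IH) => Hm l.
  by rewrite big_cons Pi.
by move/IH => Hm l; rewrite big_cons Pi.
Qed.

Lemma vdeg_leX i : vdeg_le (fun l => l == i)%N ('X_i : {mpoly F[k]}).
Proof. by move=> m /mem_msuppXP <- l; rewrite mnm1E eq_sym. Qed.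

Lemma comp_vdeg_le K (t : K.-tuple {mpoly F[k]}) (s : 'I_K -> 'I_k)
    (m : 'X_{1..K}) :
  (forall i, vdeg_le (fun l => l == s i)%N (tnth t i)) ->
  vdeg_le (fun l => \sum_i (l == s i) * m i)%N ('X_[m] \mPo t).
Proof.
move=> H; rewrite comp_mpolyX.
by apply: vdeg_le_prod => i _; apply: vdeg_le_exp.
Qed.

Lemma vdeg_divX n i (q r : {mpoly F[k]}) :
  (forall m, m \in msupp r -> m i = 0%N) ->
  q * ('X_i + r) \is a @vardeg_lt F k n ->
  forall m, m \in msupp q -> (m i < n)%N.
Proof.
move=> Hr /vardeg_ltP H m Hm; rewrite ltnNge; apply/negP => le_nm.
have step m1 : m1 \in msupp q -> (n <= m1 i)%N ->
    exists2 m2, m2 \in msupp q & m2 i = (m1 i).+1.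
  move=> Hm1 le_n.
  have [|] := boolP ((U_(i) + m1)%MM \in msupp (q * r)).
    case/msuppM_le/allpairsP => -[ma mb] /= [Ha /Hr Hb].
    move/mnmP/(_ i); rewrite !mnmDE mnm1E eqxx add1n Hb addn0 => E.
    by exists ma.
  rewrite -mcoeff_eq0 => /eqP E.
  have /H/(_ i) : (U_(i) + m1)%MM \in msupp (q * ('X_i + r)).
    by rewrite mcoeff_msupp mulrDr mcoeffD E addr0 mcoeffMX -mcoeff_msupp.
  by rewrite mnmDE mnm1E eqxx add1n => /ltnW; rewrite ltnNge le_n.
have grow N : exists2 m1, m1 \in msupp q & (n + N <= m1 i)%N.
  elim: N => [|N [m1 H1 le1]]; first by exists m; rewrite ?addn0.
  have [|m2 H2 E] := step _ H1; first exact: leq_trans (leq_addr _ _) le1.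
  by exists m2; rewrite ?E ?addnS.
have [m1 /msize_mdeg_lt lt1 le1] := grow (msize q).
move: lt1; rewrite ltnNge => /negP; apply.
apply: leq_trans (leq_addl n _) (leq_trans le1 _).
by rewrite mdegE (bigD1 i) //= leq_addr.
Qed.

End DegreeBounds.

Section Composition.
Variable F : fieldType.

Lemma comp_mpoly_comp a b c (p : {mpoly F[a]}) (t : a.-tuple {mpoly F[b]})
    (u : b.-tuple {mpoly F[c]}) :
  (p \mPo t) \mPo u = p \mPo [tuple tnth t i \mPo u | i < a].
Proof.
elim/mpolyind: p => [|d m p _ _ IH]; first by rewrite !comp_mpoly0.
rewrite !comp_mpolyD !comp_mpolyZ IH !comp_mpolyX rmorph_prod /=.
congr (_ *: _ + _); by apply: eq_bigr => i _; rewrite rmorphXn /= tnth_mktuple.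
Qed.

Lemma comp_mpolyK a (t u : a.-tuple {mpoly F[a]}) :
  (forall i, tnth t i \mPo u = 'X_i) -> cancel (comp_mpoly t) (comp_mpoly u).
Proof.
move=> H p; rewrite comp_mpoly_comp -[RHS]comp_mpoly_id; congr (_ \mPo _).
by apply: eq_from_tnth => i; rewrite !tnth_mktuple.
Qed.

(* p(t) - p(u) lies in any ideal containing all the t_i - u_i *)
Lemma comp_mpolyB_div a b (D : {mpoly F[b]}) (t u : a.-tuple {mpoly F[b]}) p :
  (forall i, exists q, tnth t i - tnth u i = D * q) ->
  exists q, (p \mPo t) - (p \mPo u) = D * q.
Proof.
move=> H; elim/mpolyind: p => [|c m p _ _ [q Hq]].
  by exists 0; rewrite !comp_mpoly0 subrr mulr0.
suff [q' Hq'] : exists q, ('X_[m] \mPo t) - ('X_[m] \mPo u) = D * q.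
  exists (c *: q' + q); rewrite !comp_mpolyD !comp_mpolyZ opprD addrACA Hq.
  by rewrite -scalerBr Hq' mulrDr scalerAr.
have divM x y x' y' : (exists q, x - y = D * q) ->
    (exists q, x' - y' = D * q) -> exists q, x * x' - y * y' = D * q.
  move=> [q1 H1] [q2 H2]; exists (q1 * x' + y * q2).
  rewrite mulrDr mulrA -H1 [D * _]mulrCA -H2.
  by rewrite mulrBl mulrBr addrA subrK.
have div1 : exists q, 1 - 1 = D * q by exists 0; rewrite subrr mulr0.
rewrite !comp_mpolyX; elim: (index_enum _) => [|i r IH]; rewrite ?big_nil //.
rewrite !big_cons; apply: (divM) IH.
by elim: (m i) => [|e IHe]; rewrite ?expr0 // !exprS; apply: divM.
Qed.

End Composition.

Section Operators.
Variable F : fieldType.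

Definition swap_tuple : 2.-tuple {mpoly F[2]} := [tuple 'X_1; 'X_0].

Definition shift_tuple (h : F) : 2.-tuple {mpoly F[2]} :=
  [tuple 'X_0 + h%:MP; 'X_1 - h%:MP].

(* The operators P and F_h of the field F(z1,z2), with z1 = 'X_0, z2 = 'X_1.  *)
Definition Pop : {fraction {mpoly F[2]}} -> {fraction {mpoly F[2]}} :=
  frac_map (comp_mpoly swap_tuple).

Definition Fop (h : F) : {fraction {mpoly F[2]}} -> {fraction {mpoly F[2]}} :=
  frac_map (comp_mpoly (shift_tuple h)).

Definition Rop (h : F) (n : nat) (f : {fraction {mpoly F[2]}}) :
    {fraction {mpoly F[2]}} :=
  Fop h f - ((h *+ n)%:MP)%:F / ('X_0 - 'X_1 + h%:MP)%:F * (Fop h f - Pop f).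

Lemma shift_tupleK h :
  cancel (comp_mpoly (shift_tuple h)) (comp_mpoly (shift_tuple (- h))).
Proof.
apply: comp_mpolyK => i; rewrite (tnth_nth 0).
case: (unliftP ord0 i) => [j ->|->]; rewrite ?[j]ord1 /=.
  rewrite comp_mpolyB comp_mpolyC comp_mpolyXU /= mpolyCN opprK addrK.
  by congr ('X_[_]); congr mnm1; apply: val_inj.
rewrite comp_mpolyD comp_mpolyC comp_mpolyXU /= mpolyCN addrNK.
by congr ('X_[_]); congr mnm1; apply: val_inj.
Qed.

Lemma swap_tupleK : cancel (comp_mpoly swap_tuple) (comp_mpoly swap_tuple).
Proof.
apply: comp_mpolyK => i; rewrite (tnth_nth 0).
case: (unliftP ord0 i) => [j ->|->]; rewrite ?[j]ord1 /= comp_mpolyXU /=;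
  by congr ('X_[_]); congr mnm1; apply: val_inj.
Qed.

Lemma Pop_frac (a b : {mpoly F[2]}) : b != 0 ->
  Pop (a%:F / b%:F) = (a \mPo swap_tuple)%:F / (b \mPo swap_tuple)%:F.
Proof. exact: frac_mapE (can_inj swap_tupleK) _ _. Qed.

Lemma Fop_frac h (a b : {mpoly F[2]}) : b != 0 ->
  Fop h (a%:F / b%:F) = (a \mPo shift_tuple h)%:F / (b \mPo shift_tuple h)%:F.
Proof. exact: frac_mapE (can_inj (shift_tupleK h)) _ _. Qed.

Lemma Pop_tofrac (p : {mpoly F[2]}) : Pop p%:F = (p \mPo swap_tuple)%:F.
Proof. exact: frac_map_tofrac (can_inj swap_tupleK) _. Qed.

Lemma Fop_tofrac h (p : {mpoly F[2]}) : Fop h p%:F = (p \mPo shift_tuple h)%:F.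
Proof. exact: frac_map_tofrac (can_inj (shift_tupleK h)) _. Qed.

Variables (h : F) (n : nat).
Implicit Type p : Vtens F 2 n.

Local Notation Rden := ('X_0 - 'X_1 + h%:MP : {mpoly F[2]}).

Lemma Rden_neq0 : Rden != 0.
Proof.
apply/eqP => /(congr1 (mcoeff U_(0))) /eqP.
rewrite mcoeffD mcoeffB !mcoeffXU mcoeffC mcoeff0 mnm1_eq0 mulr0 subr0 addr0.
by rewrite oner_eq0.
Qed.

Lemma vardeg_comp2 (t : 2.-tuple {mpoly F[2]}) (s : 'I_2 -> 'I_2) p :
  injective s -> (forall i, vdeg_le (fun l => l == s i)%N (tnth t i)) ->
  val p \mPo t \is a @vardeg_lt F 2 n.
Proof.
move=> s_inj Ht; rewrite comp_mpolyEX big_seq; apply: rpred_sum => m Hm.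
apply: rpredZ; apply: (vdeg_le_lt (comp_vdeg_le (m := m) Ht)) => l.
have [s' sK s'K] := injF_bij s_inj.
rewrite (bigD1 (s' l)) //= s'K eqxx mul1n big1 ?addn0.
  exact: (vtens_lt Hm).
move=> i ne; case: eqP => // El; case/eqP: ne.
by rewrite El sK.
Qed.

Lemma vardeg_divRden q :
  q * Rden \is a @vardeg_lt F 2 n -> q \is a @vardeg_lt F 2 n.
Proof.
have supp0 (i j : 'I_2) (c : F) : i != j ->
    forall m, m \in msupp (c%:MP + 'X_j) -> m i = 0%N.
  move=> ne m /msuppD_le; rewrite mem_cat => /orP[|/mem_msuppXP <-].
    by rewrite msuppC; case: ifP => // _; rewrite inE => /eqP->; rewrite mnm0E.
  by rewrite mnm1E eq_sym (negPf ne).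
have suppN0 (i j : 'I_2) (c : F) : i != j ->
    forall m, m \in msupp (- (c%:MP + 'X_j)) -> m i = 0%N.
  by move=> ne m; rewrite (perm_mem (msuppN _)); apply: supp0.
move=> Hq; apply/vardeg_ltP => m Hm i.
case: (unliftP ord0 i) => [j ->|->]; rewrite ?[j]ord1.
  have E : - (q * Rden) = q * ('X_1 + - (h%:MP + 'X_0)).
    by rewrite -mulrN !opprD opprK [_ + 'X_1]addrC -!addrA [- _ - _]addrC.
  have := @vdeg_divX F 2 n 1 q _ (@suppN0 1 0 h isT).
  by rewrite -E rpredN => /(_ Hq m Hm); congr (m _ < n)%N; apply: val_inj.
have E : q * Rden = q * ('X_0 + - ((- h)%:MP + 'X_1)).
  by rewrite opprD mpolyCN opprK addrAC addrA.
have := @vdeg_divX F 2 n 0 q _ (@suppN0 0 1 (- h) isT).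
by rewrite -E => /(_ Hq m Hm); congr (m _ < n)%N; apply: val_inj.
Qed.

Lemma Rop_preserves p :
  exists q : Vtens F 2 n, Rop h n (val p)%:F == (val q)%:F.
Proof.
have Fp : val p \mPo shift_tuple h \is a @vardeg_lt F 2 n.
  apply: (@vardeg_comp2 _ id) => // i; rewrite (tnth_nth 0).
  case: (unliftP ord0 i) => [j ->|->]; rewrite ?[j]ord1 /=;
    rewrite -?mpolyCN; (apply: vdeg_leD; last exact: vdeg_leC);
    move=> m /vdeg_leX Hm l; apply: leq_trans (Hm l) _; rewrite leq_eqVlt;
    apply/orP; left; apply/eqP; congr (nat_of_bool (_ == _)); exact: val_inj.
have Pp : val p \mPo swap_tuple \is a @vardeg_lt F 2 n.
  apply: (@vardeg_comp2 _ (@rev_ord 2)); first exact: rev_ord_inj.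
  move=> i; rewrite (tnth_nth 0).
  case: (unliftP ord0 i) => [j ->|->]; rewrite ?[j]ord1 /=;
    move=> m /vdeg_leX Hm l; apply: leq_trans (Hm l) _; rewrite leq_eqVlt;
    apply/orP; left; apply/eqP; congr (nat_of_bool (_ == _)); exact: val_inj.
have [q Hq] : exists q, (val p \mPo shift_tuple h) - (val p \mPo swap_tuple)
                        = Rden * q.
  apply: comp_mpolyB_div => i; rewrite !(tnth_nth 0).
  case: (unliftP ord0 i) => [j ->|->]; rewrite ?[j]ord1 /=.
    by exists (-1); rewrite mulrN1 !opprD opprK [_ + 'X_1]addrC addrAC.
  by exists 1; rewrite mulr1 addrAC.
have Vq : q \is a @vardeg_lt F 2 n.
  by apply: vardeg_divRden; rewrite mulrC -Hq rpredB.
have Vr : (val p \mPo shift_tuple h) - (h *+ n) *: q \is a @vardeg_lt F 2 n.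
  by rewrite rpredB // rpredZ.
exists (VTens Vr); rewrite /Rop Fop_tofrac Pop_tofrac -tofracB Hq /=.
rewrite tofracB -mul_mpolyC !tofracM mulrA divfK // tofrac_eq0.
exact: Rden_neq0.
Qed.

(* The restriction of Rop h n to V_n (x) V_n, see RpE. *)
Definition Rp p : Vtens F 2 n := xchoose (Rop_preserves p).

Lemma RpE p : (val (Rp p))%:F = Rop h n (val p)%:F.
Proof. by apply/esym/eqP/(xchooseP (Rop_preserves p)). Qed.

Fact Rop_aux (K : comPzRingType) (u c x y x' y' : K) :
  (c * x + y) - u * ((c * x + y) - (c * x' + y'))
  = c * (x - u * (x - x')) + (y - u * (y - y')).
Proof. by ring. Qed.

Lemma Rop_linear c (a b : {mpoly F[2]}) :
  Rop h n (c *: a + b)%:F = (c%:MP)%:F * Rop h n a%:F + Rop h n b%:F.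
Proof.
rewrite /Rop; set u := _ / _.
have E (t : 2.-tuple {mpoly F[2]}) :
    (((c *: a + b) \mPo t)%:F : {fraction {mpoly F[2]}})
    = (c%:MP)%:F * (a \mPo t)%:F + (b \mPo t)%:F.
  by rewrite comp_mpolyD comp_mpolyZ -mul_mpolyC tofracD tofracM.
rewrite !Fop_tofrac !Pop_tofrac !E.
exact: Rop_aux.
Qed.

Lemma Rp_is_linear : linear Rp.
Proof.
move=> c p q; apply/val_inj/eqP; rewrite -tofrac_eq; apply/eqP.
have E (x y : Vtens F 2 n) : val (c *: x + y) = c *: val x + val y by [].
by rewrite RpE !E Rop_linear -!RpE -mul_mpolyC tofracD tofracM.
Qed.

HB.instance Definition _ :=
  GRing.isLinear.Build F (Vtens F 2 n) (Vtens F 2 n) _ Rp Rp_is_linear.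

End Operators.

Section MonomialBasis.
Variables (F : fieldType) (k n : nat).
Implicit Type e : {ffun 'I_k -> 'I_n}.

Definition ffun_mnm e : 'X_{1..k} := [multinom (e l : nat) | l < k].

Lemma ffun_mnm_inj : injective ffun_mnm.
Proof.
move=> e e' /mnmP H; apply/ffunP => l; apply: val_inj.
by move: (H l); rewrite !mnmE.
Qed.

Lemma tmon_subproof e : 'X_[ffun_mnm e] \is a @vardeg_lt F k n.
Proof. by apply/vardeg_ltP => m /mem_msuppXP <- l; rewrite mnmE. Qed.

Definition tmon e : Vtens F k n := VTens (tmon_subproof e).

Lemma val_sum (I : Type) (r : seq I) (G : I -> Vtens F k n) :
  val (\sum_(x <- r) G x) = \sum_(x <- r) val (G x).
Proof. by elim: r => [|x r IH]; rewrite ?big_nil // !big_cons -IH. Qed.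

Lemma tmon_basis (p : Vtens F k n) : p = \sum_e (val p)@_(ffun_mnm e) *: tmon e.
Proof.
apply/val_inj/mpolyP => m; rewrite val_sum raddf_sum /=.
have E e : (val ((val p)@_(ffun_mnm e) *: tmon e))@_m
           = (val p)@_(ffun_mnm e) * (ffun_mnm e == m)%:R.
  by rewrite /= mcoeffZ mcoeffX.
rewrite (eq_bigr _ (fun e _ => E e)).
have [/vtens_lt Hm|/memN_msupp_eq0 E0] :=
  boolP (m \in msupp (val p)).
  pose e := [ffun l => Ordinal (Hm l)] : {ffun 'I_k -> 'I_n}.
  have Em : ffun_mnm e = m by apply/mnmP => l; rewrite mnmE ffunE.
  rewrite (bigD1 e) //= Em eqxx mulr1 big1 ?addr0 // => e' ne.
  by rewrite -Em (inj_eq ffun_mnm_inj) (negPf ne) mulr0.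
by rewrite E0 big1 // => e _; case: eqP => [->|_]; rewrite ?E0 ?mul0r ?mulr0.
Qed.

End MonomialBasis.

Section Factors.
Variables (F : fieldType) (k n : nat) (i j : 'I_k).
Hypothesis neq_ij : i != j.
Implicit Types (f : Vtens F 2 n) (e : {ffun 'I_k -> 'I_n}).

Definition place_val f e : {mpoly F[k]} :=
  (val f \mPo [tuple 'X_i; 'X_j]) *
  \prod_(l | (l != i) && (l != j)) 'X_l ^+ e l.

Lemma place_subproof f e : place_val f e \is a @vardeg_lt F k n.
Proof.
rewrite /place_val comp_mpolyEX mulr_suml big_seq; apply: rpred_sum => m Hm.
rewrite -scalerAl; apply: rpredZ.
have Ht a : vdeg_le (fun l => l == tnth [tuple i; j] a)%N
                (tnth [tuple 'X_i; 'X_j] a : {mpoly F[k]}).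
  rewrite !(tnth_nth i, tnth_nth 0).
  by case: (unliftP ord0 a) => [b ->|->]; rewrite ?[b]ord1 /=; exact: vdeg_leX.
have HX : forall l, (l != i) && (l != j) ->
    vdeg_le (fun l' => (l' == l) * e l)%N ('X_l ^+ e l : {mpoly F[k]}).
  by move=> l _; apply: vdeg_le_exp; exact: vdeg_leX.
have Hd := vdeg_leM (comp_vdeg_le (m := m) Ht) (vdeg_le_prod (r := index_enum _) HX).
apply: (vdeg_le_lt Hd) => l {Hd}.
rewrite !big_ord_recl big_ord0 addn0 !(tnth_nth i) /=.
have mlt := vtens_lt Hm.
have [li|ni] := eqVneq l i.
  rewrite li (negPf neq_ij) mul1n mul0n addn0 big1 ?addn0 ?mlt //.
  by move=> l' /andP[/negPf]; rewrite eq_sym => ->.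
have [lj|nj] := eqVneq l j.
  rewrite lj mul1n mul0n add0n big1 ?addn0 ?mlt //.
  by move=> l' /andP[_ /negPf]; rewrite eq_sym => ->.
rewrite !mul0n !add0n (bigD1 l) ?ni ?nj //= eqxx mul1n big1 ?addn0 //.
by move=> l' /andP[_ /negPf]; rewrite eq_sym => ->.
Qed.

(* The tensor with f in the factors i and j, and z^(e l) in each other        *)
(* factor l (the values of e at i and j are irrelevant).                      *)
Definition place f e : Vtens F k n := VTens (place_subproof f e).

Lemma place_linear e : linear (place^~ e).
Proof.
move=> c f g; apply: val_inj.
have E : val (c *: f + g) = c *: val f + val g by [].
have E' (x y : Vtens F k n) : val (c *: x + y) = c *: val x + val y by [].
rewrite E' -![val (place _ _)]/(place_val _ _) /place_val E.
by rewrite comp_mpolyD comp_mpolyZ mulrDl -scalerAl.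
Qed.

Variable R : {linear Vtens F 2 n -> Vtens F 2 n}.

(* R_ij: acts as R in the factors i and j and trivially in the other ones.    *)
(* It is defined on the monomial basis; act_place gives its value in general. *)
Definition act (p : Vtens F k n) : Vtens F k n :=
  \sum_e (val p)@_(ffun_mnm e) *:
    place (R (tmon F [ffun l : 'I_2 => e (tnth [tuple i; j] l)])) e.

Lemma act_is_linear : linear act.
Proof.
move=> c p q; rewrite /act scaler_sumr -big_split; apply: eq_bigr => e _ /=.
by rewrite mcoeffD mcoeffZ scalerDl scalerA.
Qed.

HB.instance Definition _ :=
  GRing.isLinear.Build F (Vtens F k n) (Vtens F k n) _ act act_is_linear.

Lemma act_tmon e :
  act (tmon F e) =
  place (R (tmon F [ffun l : 'I_2 => e (tnth [tuple i; j] l)])) e.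
Proof.
rewrite /act (bigD1 e) //= mcoeffX eqxx scale1r big1 ?addr0 // => e' ne.
by rewrite mcoeffX (inj_eq (@ffun_mnm_inj _ _)) eq_sym (negPf ne) scale0r.
Qed.

Lemma act_place f e : act (place f e) = place (R f) e.
Proof.
pose pl := GRing.isLinear.Build F _ _ *:%R (place^~ e) (place_linear e).
pose L : {linear Vtens F 2 n -> Vtens F k n} := HB.pack (place^~ e) pl.
rewrite -[place f e]/(L f) -[place (R f) e]/(L (R f)).
rewrite [f]tmon_basis !linear_sum; apply: eq_bigr => e2 _.
rewrite !linearZ; congr (_ *: _); rewrite /L /=.
pose e' := [ffun l => if l == i then e2 ord0 else if l == j then e2 ord_max
                      else e l].
have -> : place (tmon F e2) e = tmon F e'.
  apply: val_inj; rewrite /= /place_val comp_mpolyX [RHS]mpolyXE_id.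
  rewrite !big_ord_recl big_ord0 mulr1 !(tnth_nth 0) /=.
  rewrite [RHS](bigD1 i) //= [X in _ = _ * X](bigD1 j) 1?eq_sym //= mulrA.
  congr (_ * _ * _).
  - by rewrite !mnmE ffunE eqxx.
  - rewrite !mnmE ffunE eqxx eq_sym (negPf neq_ij).
    by congr (_ ^+ (e2 _)); apply: val_inj.
  apply: eq_bigr => l /andP[/negPf ni /negPf nj].
  by rewrite mnmE ffunE ni nj.
rewrite act_tmon.
have -> : [ffun l : 'I_2 => e' (tnth [tuple i; j] l)] = e2.
  apply/ffunP => l; rewrite !ffunE (tnth_nth i).
  case: (unliftP ord0 l) => [b ->|->]; rewrite ?[b]ord1 /= ?eqxx //.
  by rewrite eq_sym (negPf neq_ij); congr (e2 _); apply: val_inj.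
apply: val_inj; rewrite /= /place_val; congr (_ * _).
by apply: eq_bigr => l /andP[/negPf ni /negPf nj]; rewrite ffunE ni nj.
Qed.

End Factors.

Arguments Rp {F} h n p.
Arguments act {F k n} i j neq_ij R p.

(* Main.v *)
(* Write R = a F_h + b P with b(z1,z2) = hn/(z1-z2+h) and a = 1 - b.  Expanding *)
(* both triple products in the group generated by shifts and permutations of    *)
(* z1, z2, z3, the same six group elements occur on either side, and their      *)
(* coefficients agree as rational functions in z1, z2, z3.                      *)
Require Import Defs.
From mathcomp Require Import all_boot all_order all_algebra.
From mathcomp Require Import mpoly ring.

Set Implicit Arguments.
Unset Strict Implicit.
Unset Printing Implicit Defensive.

Import GRing.Theory.
Local Open Scope ring_scope.

(** Clearing the denominator turns R into the relation (a - b + h) (Rf)(a,b) = (a - b + h - hn)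
    f(a+h,b-h) + hn f(b,a), valid for arbitrary polynomials a, b ([comp_pair_Rp]); [comp_act]
    carries it over to R_ij. Three nested uses express either triple product at (z1,z2,z3) through
    eight values of the argument, at only six distinct points ([ybe_pointwise]). The denominators
    are nonzero at the generic point, so the coefficients can be compared in the field of fractions,
    where w = u + v makes them agree ([ybe_field]). *)

(* u = z1 - z2 + h, v = z2 - z3 + h, w = z1 - z3 + 2h, k = hn; the p's are the  *)
(* values of the argument under the six group elements, the q's and r's those  *)
(* of the partial products.                                                     *)
Lemma ybe_field (K : fieldType) (u v w k p1 p2 p3 p4 p5 p6 : K)
    (s r1 r2 q1 q2 q3 q4 s' r1' r2' q1' q2' q3' q4' : K) :
  u != 0 -> v != 0 -> w != 0 -> w = u + v ->
  u * s = (u - k) * r1 + k * r2 ->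
  w * r1 = (w - k) * q1 + k * q2 ->
  v * r2 = (v - k) * q3 + k * q4 ->
  v * q1 = (v - k) * p1 + k * p2 ->
  - u * q2 = (- u - k) * p3 + k * p4 ->
  w * q3 = (w - k) * p5 + k * p6 ->
  u * q4 = (u - k) * p4 + k * p3 ->
  v * s' = (v - k) * r1' + k * r2' ->
  w * r1' = (w - k) * q1' + k * q2' ->
  u * r2' = (u - k) * q3' + k * q4' ->
  u * q1' = (u - k) * p1 + k * p5 ->
  - v * q2' = (- v - k) * p3 + k * p6 ->
  w * q3' = (w - k) * p2 + k * p4 ->
  v * q4' = (v - k) * p6 + k * p3 ->
  s = s'.
Proof.
move=> u0 v0 w0 Ew.
have nu0 : - u != 0 by rewrite oppr_eq0.
have nv0 : - v != 0 by rewrite oppr_eq0.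
have dv (d a b : K) : d != 0 -> d * a = b -> a = b / d.
  by move=> d0 <-; rewrite mulrC mulKf.
move=> /(dv _ _ _ u0)-> /(dv _ _ _ w0)-> /(dv _ _ _ v0)->.
move=> /(dv _ _ _ v0)-> /(dv _ _ _ nu0)-> /(dv _ _ _ w0)-> /(dv _ _ _ u0)->.
move=> /(dv _ _ _ v0)-> /(dv _ _ _ w0)-> /(dv _ _ _ u0)->.
move=> /(dv _ _ _ u0)-> /(dv _ _ _ nv0)-> /(dv _ _ _ w0)-> /(dv _ _ _ v0)->.
(* The coefficients of [p1], [p2], [p5] are the same product on both sides. Those of [p4] and [p6]
   agree since 1/v - 1/w = u/(vw) and 1/u - 1/w = v/(uw), by w = u + v; that of [p3] is k/w +
   k^3/(uvw) on both sides. *)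
subst; field.
by rewrite u0 v0 w0 nv0 nu0.
Qed.

(* p, q, r, s are functions of three arguments in A, for instance a polynomial *)
(* in three variables evaluated at three elements of A.                        *)
Lemma ybe_pointwise (A : comNzRingType) (K : fieldType) (f : {rmorphism A -> K})
    (h k : A) (p q r s q' r' s' : A -> A -> A -> K) :
  let acts12 p q := forall a b c, f (a - b + h) * q a b c =
    (f (a - b + h) - f k) * p (a + h) (b - h) c + f k * p b a c in
  let acts13 p q := forall a b c, f (a - c + h) * q a b c =
    (f (a - c + h) - f k) * p (a + h) b (c - h) + f k * p c b a in
  let acts23 p q := forall a b c, f (b - c + h) * q a b c =
    (f (b - c + h) - f k) * p a (b + h) (c - h) + f k * p a c b in
  acts23 p q -> acts13 q r -> acts12 r s ->
  acts12 p q' -> acts13 q' r' -> acts23 r' s' ->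
  forall x y z, f (x - y + h) != 0 -> f (y - z + h) != 0 ->
    f (x - z + h *+ 2) != 0 ->
  s x y z = s' x y z.
Proof.
move=> acts12 acts13 acts23 Hq Hr Hs Hq' Hr' Hs' x y z u0 v0 w0.
(* With the shifted arguments and the denominator as variables, a relation can be applied at points
   already in simplified form; the equations left over are ring identities. *)
have e12 u v : acts12 u v -> forall a b c a' b' d,
    a + h = a' -> b - h = b' -> f (a - b + h) = d ->
    d * v a b c = (d - f k) * u a' b' c + f k * u b a c.
  by move=> H a b c _ _ _ <- <- <-; exact: H.
have e13 u v : acts13 u v -> forall a b c a' c' d,
    a + h = a' -> c - h = c' -> f (a - c + h) = d ->
    d * v a b c = (d - f k) * u a' b c' + f k * u c b a.
  by move=> H a b c _ _ _ <- <- <-; exact: H.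
have e23 u v : acts23 u v -> forall a b c b' c' d,
    b + h = b' -> c - h = c' -> f (b - c + h) = d ->
    d * v a b c = (d - f k) * u a b' c' + f k * u a c b.
  by move=> H a b c _ _ _ <- <- <-; exact: H.
have a2 a : a + h + h = a + h *+ 2 by ring.
have s2 a : a - h - h = a - h *+ 2 by ring.
(* Each relation leads from a point to its shift and its transposition. Two paths meet at [p3] and
   [p4] on the left, at [p3] and [p6] on the right; one path of each such pair has denominator -u or
   -v. *)
apply: (@ybe_field K _ _ _ (f k) (p (x + h *+ 2) y (z - h *+ 2))
  (p (x + h *+ 2) (z - h) (y - h)) (p z y x) (p z (x + h) (y - h))
  (p (y + h) (x + h) (z - h *+ 2)) (p (y + h) (z - h) x) _
  (r (x + h) (y - h) z) (r y x z)
  (q (x + h *+ 2) (y - h) (z - h)) (q z (y - h) (x + h))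
  (q (y + h) x (z - h)) (q z x y) _
  (r' x (y + h) (z - h)) (r' x z y)
  (q' (x + h) (y + h) (z - h *+ 2)) (q' (z - h) (y + h) x)
  (q' (x + h) z (y - h)) (q' y z x) u0 v0 w0);
  [ | apply: e12 Hs _ _ _ _ _ _ _ _ _ | apply: e13 Hr _ _ _ _ _ _ _ _ _
    | apply: e13 Hr _ _ _ _ _ _ _ _ _ | apply: e23 Hq _ _ _ _ _ _ _ _ _
    | apply: e23 Hq _ _ _ _ _ _ _ _ _ | apply: e23 Hq _ _ _ _ _ _ _ _ _
    | apply: e23 Hq _ _ _ _ _ _ _ _ _ | apply: e23 Hs' _ _ _ _ _ _ _ _ _
    | apply: e13 Hr' _ _ _ _ _ _ _ _ _ | apply: e13 Hr' _ _ _ _ _ _ _ _ _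
    | apply: e12 Hq' _ _ _ _ _ _ _ _ _ | apply: e12 Hq' _ _ _ _ _ _ _ _ _
    | apply: e12 Hq' _ _ _ _ _ _ _ _ _ | apply: e12 Hq' _ _ _ _ _ _ _ _ _ ];
  rewrite ?a2 ?s2 ?addrK ?subrK // -?rmorphN -?rmorphD; congr (f _); ring.
Qed.

(** As an identity between polynomials, the definition of R can be evaluated anywhere, even where
    the denominator vanishes. *)
Lemma Rp_clear_denominator (F : fieldType) (h : F) n (p : Vtens F 2 n) :
  ('X_0 - 'X_1 + h%:MP) * val (Rp h n p) =
  ('X_0 - 'X_1 + h%:MP - (h *+ n)%:MP) * (val p \mPo shift_tuple h)
  + (h *+ n)%:MP * (val p \mPo swap_tuple F).
Proof.
set D := _ + h%:MP; have D0 : D != 0 by exact: Rden_neq0.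
apply/eqP; rewrite -tofrac_eq tofracM RpE /Rop -/D Fop_tofrac Pop_tofrac.
clearbody D; rewrite mulrBr mulrA [_ * (_ / _)]mulrC divfK ?tofrac_eq0 //.
by rewrite tofracD !tofracM tofracB mulrBr mulrBl opprB addrA addrAC.
Qed.

Lemma comp_pair_tmon (F : fieldType) n m (e : {ffun 'I_2 -> 'I_n})
    (a b : {mpoly F[m]}) :
  tmon F e \mPo [tuple a; b] = a ^+ e 0 * b ^+ e 1.
Proof.
rewrite comp_mpolyX big_ord_recl big_ord1 !mnmE !(tnth_nth 0) /=.
by congr (_ * _ ^+ e _); apply: val_inj.
Qed.

Lemma comp_pair_Rp (F : fieldType) n m (h : F) (p : Vtens F 2 n)
    (a b : {mpoly F[m]}) :
  (a - b + h%:MP) * (Rp h n p \mPo [tuple a; b]) =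
  (a - b + h%:MP - (h *+ n)%:MP) * (p \mPo [tuple a + h%:MP; b - h%:MP])
  + (h *+ n)%:MP * (p \mPo [tuple b; a]).
Proof.
have := congr1 (comp_mpoly [tuple a; b]) (Rp_clear_denominator h p).
have pairE (q : 2.-tuple {mpoly F[2]}) :
    [tuple tnth q l \mPo [tuple a; b] | l < 2] =
    [tuple q`_0 \mPo [tuple a; b]; q`_1 \mPo [tuple a; b]].
  apply: eq_from_tnth => l; rewrite tnth_mktuple !(tnth_nth 0).
  by case: (unliftP ord0 l) => [l' ->|->]; rewrite ?[l']ord1.
rewrite comp_mpolyD !rmorphM /=
  !(comp_mpolyB, comp_mpolyD, comp_mpolyC, comp_mpolyXU) /=.
by rewrite !comp_mpoly_comp !pairE /=
  !(comp_mpolyB, comp_mpolyD, comp_mpolyC, comp_mpolyXU) /=.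
Qed.

Section ActRelation.
Variables (F : fieldType) (k n : nat) (h : F) (i j : 'I_k) (neq_ij : i != j).
Variables (m : nat) (t : k.-tuple {mpoly F[m]}).

Local Notation ti := (tnth t i).
Local Notation tj := (tnth t j).

Definition subst2 (a b : {mpoly F[m]}) : k.-tuple {mpoly F[m]} :=
  [tuple if l == i then a else if l == j then b else tnth t l | l < k].

Lemma comp_subst2_tmon (e : {ffun 'I_k -> 'I_n}) a b :
  tmon F e \mPo subst2 a b =
  a ^+ e i * b ^+ e j * \prod_(l | (l != i) && (l != j)) tnth t l ^+ e l.
Proof.
rewrite comp_mpolyX (bigD1 i) //= (bigD1 j) 1?eq_sym //= mulrA.
rewrite !tnth_mktuple !mnmE !eqxx eq_sym (negPf neq_ij); congr (_ * _).
apply: eq_bigr => l /andP[/negPf ni /negPf nj].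
by rewrite tnth_mktuple mnmE ni nj.
Qed.

(** Both sides are linear in [p]. On a monomial, the factors other than i and j contribute the same
    product to every term, and what remains is [comp_pair_Rp]. *)
Lemma comp_act (p : Vtens F k n) :
  (ti - tj + h%:MP) * (act i j neq_ij (Rp h n) p \mPo t) =
  (ti - tj + h%:MP - (h *+ n)%:MP) *
    (p \mPo subst2 (ti + h%:MP) (tj - h%:MP))
  + (h *+ n)%:MP * (p \mPo subst2 tj ti).
Proof.
rewrite [p]tmon_basis linear_sum !val_sum !raddf_sum /= !mulr_sumr -big_split.
apply: eq_bigr => e _ /=; rewrite linearZ /=.
rewrite !comp_mpolyZ -!scalerAr -scalerDr; congr (_ *: _).
rewrite -['X_[ffun_mnm e]]/(vtens_val (tmon F e)).
rewrite act_tmon !comp_subst2_tmon !mulrA -mulrDl /= /place_val rmorphM /=.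
rewrite mulrA rmorph_prod /=; congr (_ * _); last first.
  by apply: eq_bigr => l _; rewrite rmorphXn /= comp_mpolyXU -tnth_nth.
rewrite comp_mpoly_comp.
have -> : [tuple tnth [tuple 'X_i; 'X_j] l \mPo t | l < 2] = [tuple ti; tj].
  apply: eq_from_tnth => l; rewrite tnth_mktuple !(tnth_nth 0).
  case: (unliftP ord0 l) => [l' ->|->]; rewrite ?[l']ord1 /=;
    by rewrite comp_mpolyXU -tnth_nth.
by rewrite comp_pair_Rp !comp_pair_tmon !ffunE !(tnth_nth i) /= !mulrA.
Qed.

End ActRelation.

Theorem theorem1p4 (F : closedFieldType) (charF0 : [pchar F] =i pred0)
    (h : F) (n : nat) (n_gt0 : (0 < n)%N) :
  let R : {linear Vtens F 2 n -> Vtens F 2 n} := Rp h n in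
  let R12 : Vtens F 3 n -> Vtens F 3 n := act (0 : 'I_3) (1 : 'I_3) isT R in
  let R13 : Vtens F 3 n -> Vtens F 3 n := act (0 : 'I_3) (2 : 'I_3) isT R in
  let R23 : Vtens F 3 n -> Vtens F 3 n := act (1 : 'I_3) (2 : 'I_3) isT R in
  R12 \o R13 \o R23 =1 R23 \o R13 \o R12.
Proof.
move=> R R12 R13 R23 p; apply: val_inj => /=; apply/eqP.
pose A := {mpoly F[3]}.
(* Values are taken in the field of fractions, into which polynomials embed; by [evX], the value at
   the generic point determines the tensor. *)
pose ev (u : Vtens F 3 n) (a b c : A) : {fraction A} :=
  (u \mPo [tuple a; b; c])%:F.
have evX u : ev u 'X_0 'X_1 'X_2 = (vtens_val u)%:F.
  rewrite /ev -[in RHS](comp_mpoly_id u); congr ((_ \mPo _)%:F).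
  apply: eq_from_tnth => l; rewrite tnth_mktuple (tnth_nth 0).
  by case: l => [[|[|[|//]]] l3] /=; congr ('X_[U_(_)]); apply: val_inj.
have triple (t : 3.-tuple A) : t = [tuple tnth t 0; tnth t 1; tnth t 2].
  apply: eq_from_tnth => l; rewrite [RHS](tnth_nth 0).
  by case: l => [[|[|[|//]]] l3] /=; congr tnth; apply: val_inj.
have act12 u a b c : (a - b + h%:MP)%:F * ev (R12 u) a b c =
    ((a - b + h%:MP)%:F - ((h *+ n)%:MP)%:F) * ev u (a + h%:MP) (b - h%:MP) c
    + ((h *+ n)%:MP)%:F * ev u b a c.
  rewrite -tofracB -!tofracM -tofracD; congr (_%:F).
  have := @comp_act F 3 n h 0 1 isT 3 [tuple a; b; c] u.
  by rewrite [subst2 _ _ _ (_ + _) _]triple [subst2 _ _ _ b a]triple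
    !tnth_mktuple !(tnth_nth 0).
have act13 u a b c : (a - c + h%:MP)%:F * ev (R13 u) a b c =
    ((a - c + h%:MP)%:F - ((h *+ n)%:MP)%:F) * ev u (a + h%:MP) b (c - h%:MP)
    + ((h *+ n)%:MP)%:F * ev u c b a.
  rewrite -tofracB -!tofracM -tofracD; congr (_%:F).
  have := @comp_act F 3 n h 0 2 isT 3 [tuple a; b; c] u.
  by rewrite [subst2 _ _ _ (_ + _) _]triple [subst2 _ _ _ c a]triple
    !tnth_mktuple !(tnth_nth 0).
have act23 u a b c : (b - c + h%:MP)%:F * ev (R23 u) a b c =
    ((b - c + h%:MP)%:F - ((h *+ n)%:MP)%:F) * ev u a (b + h%:MP) (c - h%:MP)
    + ((h *+ n)%:MP)%:F * ev u a c b.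
  rewrite -tofracB -!tofracM -tofracD; congr (_%:F).
  have := @comp_act F 3 n h 1 2 isT 3 [tuple a; b; c] u.
  by rewrite [subst2 _ _ _ (_ + _) _]triple [subst2 _ _ _ c b]triple
    !tnth_mktuple !(tnth_nth 0).
(* The coefficient of z_i is 1, whatever the constant [c]; this covers the shifts h and 2h. *)
have den0 (i j : 'I_3) (c : F) : i != j -> ('X_i - 'X_j + c%:MP)%:F != 0.
  move=> ne; rewrite tofrac_eq0; apply/eqP => /(congr1 (mcoeff U_(i))) /eqP.
  rewrite mcoeffD mcoeffB !mcoeffXU mcoeffC mcoeff0 mnm1_eq0 mulr0 addr0 eqxx.
  by rewrite [j == i]eq_sym (negPf ne) subr0 oner_eq0.
clearbody ev R12 R13 R23.
rewrite -tofrac_eq -(evX (R12 _)) -(evX (R23 _)); apply/eqP.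
have ybe := @ybe_pointwise A {fraction A} (@FracField.tofrac A) h%:MP
  (h *+ n)%:MP (ev p) (ev (R23 p)) (ev (R13 (R23 p))) (ev (R12 (R13 (R23 p))))
  (ev (R12 p)) (ev (R13 (R12 p))) (ev (R23 (R13 (R12 p)))).
apply: (ybe (act23 p) (act13 _) (act12 _) (act12 p) (act13 _) (act23 _)).
- exact: den0.
- exact: den0.
- by rewrite -[h%:MP *+ 2]rmorphMn; apply: den0.
Qed.
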